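(* Let $X,Y$ be nonempty finite sets, let $\mathcal{G}_X$ and $\mathcal{G}_Y$ be dynamic graphs over $X$ and $Y$ respectively, and let $\theta_X=\pi_0\circ\mathcal{G}_X$ and $\theta_Y=\pi_0\circ\mathcal{G}_Y$ be their formigrams. Then $$d_{\mathrm I}^{\mathrm F}(\theta_X,\theta_Y)\le d_{\mathrm I}^{\mathrm{dynG}}(\mathcal{G}_X,\mathcal{G}_Y).$$
   Context: Lattices. $\mathrm{Graph}(X)$ is the lattice of subgraphs $(V,E)$ ($V\subset X$) of the complete graph on $X$, ordered by inclusion; join is union. A subpartition of $X$ is a partition of a (possibly empty) subset of $X$; $\mathrm{SubPart}(X)$ is the lattice of subpartitions, ordered by $P\le Q$ iff every block of $P$ is contained in a block of $Q$. $\pi_0:\mathrm{Graph}(X)\to\mathrm{SubPart}(X)$ sends $(V,E)$ to the partition of $V$ into vertex sets of connected components. Cosheaf-inducing maps. For a join-semilattice $L$, a map $f:\mathbb{R}\to L$ is cosheaf-inducing if there is a locally finite $C\subset\mathbb{R}$ such that $f$ is constant on each connected component of $\mathbb{R}\setminus C$ and for every $c\in C$ there is $r_c>0$ with $f(c-\varepsilon)\le f(c)\ge f(c+\varepsilon)$ for all $\varepsilon\in[0,r_c)$. For $I\in\mathbf{Int}$ (nonempty bounded closed real intervals) put $\bigvee_If=\bigvee\{f(t):t\in I\}$, and $I^\varepsilon=[b-\varepsilon,d+\varepsilon]$ for $I=[b,d]$. For two such maps, $d_{\mathrm I}^{L}(f,g)=\inf\{\varepsilon\ge0:\forall I\in\mathbf{Int},\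 \bigvee_If\le\bigvee_{I^\varepsilon}g,\ \bigvee_Ig\le\bigvee_{I^\varepsilon}f\}$. A dynamic graph over $X$ is a cosheaf-inducing map $\mathcal{G}_X=(V_X(\cdot),E_X(\cdot)):\mathbb{R}\to\mathrm{Graph}(X)$ such that each $x\in X$ has a (nonempty) closed interval $I_x$ with $x\in V_X(t)$ iff $t\in I_x$. A formigram over $X$ is a cosheaf-inducing map $\theta_X:\mathbb{R}\to\mathrm{SubPart}(X)$ such that each $x\in X$ has a (nonempty) closed interval $I_x$ with $x\in\bigcup\theta_X(t)$ iff $t\in I_x$. If $\mathcal{G}_X$ is a dynamic graph, $\pi_0\circ\mathcal{G}_X$ is a formigram. Tripods and distances. A tripod between $X$ and $Y$ is a set $Z$ with surjections $\varphi_X:Z\to X$, $\varphi_Y:Z\to Y$. For $\varphi:Z\to X$ surjective, $\varphi^*\mathcal{G}_X$ is the dynamic graph over $Z$ with vertex set $\varphi^{-1}(V_X(t))$ at time $t$ and with distinct $z,z'$ adjacent iff $\{\varphi(z),\varphi(z')\}\in E_X(t)$ or $\varphi(z)=\varphi(z')\in V_X(t)$; and $(\varphi^*\theta_X)(t)=\{\varphi^{-1}(B):B\in\theta_X(t)\}$. A tripod is an $\varepsilon$-tripod between $\mathcal{G}_X,\mathcal{G}_Y$ if $d_{\mathrm I}^{\mathrm{Graph}(Z)}(\varphi_X^*\mathcal{G}_X,\varphi_Y^*\mathcal{G}_Y)\le\varepsilon$, and an $\varepsilon$-tripod between $\theta_X,\theta_Y$ if $d_{\mathrm I}^{\mathrm{SubPart}(Z)}(\varphi_X^*\theta_X,\varphi_Y^*\theta_Y)\le\varepsilon$.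 $d_{\mathrm I}^{\mathrm{dynG}}(\mathcal{G}_X,\mathcal{G}_Y)$ (resp. $d_{\mathrm I}^{\mathrm F}(\theta_X,\theta_Y)$) is the minimum (infimum) of $\varepsilon\ge0$ admitting an $\varepsilon$-tripod, $+\infty$ if none. *)

(* Defs.v *)
From HB Require Import structures.
From Stdlib Require Import Relation_Operators.
From mathcomp Require Import all_boot all_order all_algebra.
From mathcomp Require Import all_classical all_reals all_analysis.
Set Implicit Arguments.
Unset Strict Implicit.
Unset Printing Implicit Defensive.
Import Order.TTheory GRing.Theory Num.Theory.
Import numFieldNormedType.Exports.
Local Open Scope classical_set_scope.
Local Open Scope ring_scope.

(* A subgraph of the complete graph on X. The set of edges, which are unordered
   pairs of distinct vertices, is a symmetric irreflexive relation. *)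
Record graph (X : Type) := Graph {
  vertices : set X;
  edge : X -> X -> Prop;
  edge_sym : forall x y, edge x y -> edge y x;
  edge_irr : forall x, ~ edge x x;
  edge_vertices : forall x y, edge x y -> vertices x
}.

HB.instance Definition _ (X : Type) := gen_eqMixin (graph X).
HB.instance Definition _ (X : Type) := gen_choiceMixin (graph X).

Fact graph_display : Order.disp_t. Proof. exact: (Order.Disp tt tt). Qed.

Section GraphLattice.
Variable X : Type.
Implicit Types G H K : graph X.

Definition subgraph G H : Prop :=
  vertices G `<=` vertices H /\ forall x y, edge G x y -> edge H x y.

Lemma graph_eq G H : vertices G = vertices H -> edge G = edge H -> G = H.
Proof.
case: G H => [V E s i v] [V' E' s' i' v'] /= eV eE; subst V' E'.
by rewrite (Prop_irrelevance s s') (Prop_irrelevance i i')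
  (Prop_irrelevance v v').
Qed.

Fact subgraph_refl : reflexive (fun G H => `[< subgraph G H >]).
Proof. by move=> G; apply/asboolP; split. Qed.

Fact subgraph_anti : antisymmetric (fun G H => `[< subgraph G H >]).
Proof.
move=> G H /andP[/asboolP[V1 E1] /asboolP[V2 E2]].
apply: graph_eq; first exact/seteqP.
by apply/funext => x; apply/funext => y; apply/propext; split; [exact: E1|exact: E2].
Qed.

Fact subgraph_trans : transitive (fun G H => `[< subgraph G H >]).
Proof.
move=> H G K /asboolP[V1 E1] /asboolP[V2 E2]; apply/asboolP; split.
  exact: subset_trans V1 V2.
by move=> x y /E1 /E2.
Qed.

HB.instance Definition _ := Order.Le_isPOrder.Build graph_display (graph X)
  subgraph_refl subgraph_anti subgraph_trans.

Lemma le_graphP G H : reflect (subgraph G H) (G <= H)%O.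
Proof. exact: asboolP. Qed.

Definition graph_join G H : graph X.
Proof.
refine (@Graph X (vertices G `|` vertices H)
  (fun x y => edge G x y \/ edge H x y) _ _ _).
- by move=> x y [] xy; [left|right]; exact: edge_sym xy.
- by move=> x []; exact: edge_irr.
- by move=> x y [] xy; [left|right]; exact: edge_vertices xy.
Defined.

Definition graph_meet G H : graph X.
Proof.
refine (@Graph X (vertices G `&` vertices H)
  (fun x y => edge G x y /\ edge H x y) _ _ _).
- by move=> x y [Gxy Hxy]; split; exact: edge_sym.
- by move=> x [+ _]; exact: edge_irr.
- by move=> x y [Gxy Hxy]; split; [exact: edge_vertices Gxy|exact: edge_vertices Hxy].
Defined.

Fact graph_meetP G H K :
  (G <= graph_meet H K)%O = (G <= H)%O && (G <= K)%O.
Proof.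
apply/idP/andP => [/le_graphP[V E]|[/le_graphP[V1 E1] /le_graphP[V2 E2]]].
  by split; apply/le_graphP; split=> [x /V[]//|x y /E[]].
apply/le_graphP; split=> [x Vx|x y Exy]; first by split; [exact: V1|exact: V2].
by split; [exact: E1|exact: E2].
Qed.

Fact graph_joinP G H K :
  (graph_join G H <= K)%O = (G <= K)%O && (H <= K)%O.
Proof.
apply/idP/andP => [/le_graphP[V E]|[/le_graphP[V1 E1] /le_graphP[V2 E2]]].
  split; apply/le_graphP; split=> [x ?|x y ?];
    by [apply: V; left|apply: V; right|apply: E; left|apply: E; right].
by apply/le_graphP; split=> [x [/V1|/V2]//|x y [/E1|/E2]].
Qed.

HB.instance Definition _ := Order.POrder_MeetJoin_isLattice.Build
  graph_display (graph X) graph_meetP graph_joinP.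

End GraphLattice.

Record subpart (X : Type) := SubPart {
  blocks : set (set X);
  blocks_partition : exists A : set X, partition blocks id A
}.

HB.instance Definition _ (X : Type) := gen_eqMixin (subpart X).
HB.instance Definition _ (X : Type) := gen_choiceMixin (subpart X).

Fact subpart_display : Order.disp_t. Proof. exact: (Order.Disp tt tt). Qed.

Section SubPartLattice.
Variable X : Type.
Implicit Types (P Q S : subpart X) (G : graph X).

(* The union of the blocks of P. *)
Definition underlying_set P : set X := cover (blocks P) id.

Lemma block_neq0 P B : blocks P B -> B !=set0.
Proof. by case: P => bl [A [_ _ ne]] /= /ne. Qed.

Lemma block_uniq P B C x : blocks P B -> blocks P C -> B x -> C x -> B = C.
Proof.
case: P => bl [A [_ tr _]] /= PB PC Bx Cx.
by apply: (tr B C) => //; exists x.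
Qed.

Lemma subpart_eq P Q : blocks P = blocks Q -> P = Q.
Proof.
case: P Q => [bl p] [bl' p'] /= e; subst bl'.
by rewrite (Prop_irrelevance p p').
Qed.

Definition refines P Q : Prop :=
  forall B, blocks P B -> exists2 C, blocks Q C & B `<=` C.

Fact refines_refl : reflexive (fun P Q => `[< refines P Q >]).
Proof. by move=> P; apply/asboolP => B PB; exists B. Qed.

Fact refines_anti : antisymmetric (fun P Q => `[< refines P Q >]).
Proof.
suff H P Q : refines P Q -> refines Q P -> blocks P `<=` blocks Q.
  move=> P Q /andP[/asboolP PQ /asboolP QP].
  by apply/subpart_eq/seteqP; split; exact: H.
move=> PQ QP B PB; have [C QC BC] := PQ _ PB; have [D PD CD] := QP _ QC.
have [x Bx] := block_neq0 PB.
have BD : B = D by apply: (block_uniq PB PD Bx); exact/CD/BC.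
suff -> : B = C by [].
by apply/seteqP; split; rewrite // BD.
Qed.

Fact refines_trans : transitive (fun P Q => `[< refines P Q >]).
Proof.
move=> Q P S /asboolP PQ /asboolP QS; apply/asboolP => B /PQ[C /QS[D SD CD] BC].
by exists D => //; exact: subset_trans BC CD.
Qed.

HB.instance Definition _ := Order.Le_isPOrder.Build subpart_display (subpart X)
  refines_refl refines_anti refines_trans.

Lemma le_subpartP P Q : reflect (refines P Q) (P <= Q)%O.
Proof. exact: asboolP. Qed.

Definition component G (x : X) : set X :=
  [set y | clos_refl_trans X (edge G) x y].

Lemma component_sym G x y : component G x y -> component G y x.
Proof.
elim=> {x y} [x y xy|x|x y z _ yx _ zy]; last exact: rt_trans zy yx.
  by apply: rt_step; exact: edge_sym.
exact: rt_refl.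
Qed.

Lemma component_vertices G x :
  vertices G x -> component G x `<=` vertices G.
Proof.
move=> + y xy; elim: xy => {x y} [x y xy _|//|].
  exact: edge_vertices (edge_sym xy).
by move=> x y z _ h1 _ h2 /h1 /h2.
Qed.

Lemma component_eq G x y : component G x y -> component G x = component G y.
Proof.
move=> xy; apply/seteqP; split=> z; last exact: rt_trans.
by apply: rt_trans; exact: component_sym.
Qed.

Fact pi0_subproof G :
  exists A, partition [set component G x | x in vertices G] id A.
Proof.
exists (cover [set component G x | x in vertices G] id); split=> //.
  move=> _ _ [x _ <-] [y _ <-] [z [/= xz yz]].
  by rewrite (component_eq xz) (component_eq yz).
by move=> _ [x _ <-]; exists x; exact: rt_refl.
Qed.

Definition pi0 G : subpart X := SubPart (pi0_subproof G).

Lemma underlying_set_pi0 G : underlying_set (pi0 G) = vertices G.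
Proof.
apply/seteqP; split=> [y [_ [x Gx <-]]|x Gx]; first exact: component_vertices.
by exists (component G x); [exists x|exact: rt_refl].
Qed.

(* The disjoint union of the complete graphs on the blocks of P. *)
Definition cliques P : graph X.
Proof.
refine (@Graph X (underlying_set P)
  (fun x y => x <> y /\ exists B, [/\ blocks P B, B x & B y]) _ _ _).
- by move=> x y [xy [B [PB Bx By]]]; split; [exact: nesym|exists B].
- by move=> x [].
- by move=> x y [_ [B [PB Bx _]]]; exists B.
Defined.

Lemma pi0_le G P : (pi0 G <= P)%O = (G <= cliques P)%O.
Proof.
apply/idP/idP => [/le_subpartP GP|/le_graphP[V E]].
  apply/le_graphP; split=> [x Gx|x y xy].
    have [|B PB] := GP (component G x); first by exists x.
    by move=> /(_ x (rt_refl _ _ _)) Bx; exists B.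
  split; first by move=> e; move: xy; rewrite e; exact: edge_irr.
  have [|B PB] := GP (component G x).
    by exists x => //; exact: edge_vertices xy.
  move=> sB; exists B; split=> //; apply: sB; [exact: rt_refl|exact: rt_step].
apply/le_subpartP => _ [x Gx <-].
have [B PB /= Bx] := V _ Gx; exists B => // y xy.
elim: xy Bx => {x y Gx} [x y /E[_ [C [PC Cx Cy]]] Bx|//|x y z _ h1 _ h2 /h1/h2 //].
by rewrite (block_uniq PB PC Bx Cx).
Qed.

Lemma pi0_cliques P : pi0 (cliques P) = P.
Proof.
apply/eqP; rewrite eq_le pi0_le lexx /=.
apply/le_subpartP => B PB; have [x Bx] := block_neq0 PB.
exists (component (cliques P) x); first by exists x => //; exists B.
move=> y By; have [->|xy] := pselect (x = y); first exact: rt_refl.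
by apply: rt_step; split=> //; exists B.
Qed.

Lemma pi0_homo : {homo pi0 : G H / (G <= H)%O}.
Proof.
by move=> G H GH; rewrite pi0_le (le_trans GH)// -pi0_le lexx.
Qed.

Lemma cliques_le P Q : (cliques P <= cliques Q)%O = (P <= Q)%O.
Proof. by rewrite -pi0_le pi0_cliques. Qed.

Definition subpart_join P Q : subpart X :=
  pi0 (graph_join (cliques P) (cliques Q)).

Definition subpart_meet P Q : subpart X :=
  pi0 (graph_meet (cliques P) (cliques Q)).

Fact subpart_meetP P Q S :
  (P <= subpart_meet Q S)%O = (P <= Q)%O && (P <= S)%O.
Proof.
apply/idP/idP => [PQS|/andP[PQ PS]].
  by apply/andP; split; apply: (le_trans PQS); rewrite pi0_le;
    have := lexx (graph_meet (cliques Q) (cliques S));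
    rewrite graph_meetP => /andP[].
rewrite -(pi0_cliques P); apply: pi0_homo.
by rewrite graph_meetP !cliques_le PQ.
Qed.

Fact subpart_joinP P Q S :
  (subpart_join P Q <= S)%O = (P <= S)%O && (Q <= S)%O.
Proof. by rewrite pi0_le graph_joinP !cliques_le. Qed.

HB.instance Definition _ := Order.POrder_MeetJoin_isLattice.Build
  subpart_display (subpart X) subpart_meetP subpart_joinP.

End SubPartLattice.

Section CosheafInducing.
Variables (R : realType) (disp : Order.disp_t) (L : joinSemilatticeType disp).
Implicit Types (f g : R -> L) (C : set R).

Definition locally_finite C : Prop :=
  forall x : R, exists2 U, nbhs x U & finite_set (U `&` C).

Definition cosheaf_inducing f : Prop :=
  exists C : set R, [/\ locally_finite C,
    forall x y, connected_component (~` C) x y -> f x = f y &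
    forall c, C c -> exists2 r : R, 0 < r &
      forall e, 0 <= e < r -> (f (c - e) <= f c)%O /\ (f (c + e) <= f c)%O].

(* The join of f over the interval [b, d]. A cosheaf-inducing map takes finitely
   many values on [b, d], so that for b <= d the supremum exists and the default
   value f b of supremum plays no role. *)
Definition interval_join f (b d : R) : L := supremum (f b) (f @` `[b, d]).

Definition interleaved (e : R) f g : Prop :=
  forall b d : R, b <= d ->
    (interval_join f b d <= interval_join g (b - e) (d + e))%O /\
    (interval_join g b d <= interval_join f (b - e) (d + e))%O.

Definition dI f g : \bar R :=
  ereal_inf [set e%:E | e in [set e : R | 0 <= e /\ interleaved e f g]].

End CosheafInducing.

Lemma cosheaf_inducing_comp (R : realType) (d1 d2 : Order.disp_t)
    (L : joinSemilatticeType d1) (M : joinSemilatticeType d2)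
    (h : L -> M) (f : R -> L) :
  {homo h : x y / (x <= y)%O} -> cosheaf_inducing f ->
  cosheaf_inducing (h \o f).
Proof.
move=> hh [C [lfC cst pk]]; exists C; split=> //.
  by move=> x y /cst /= ->.
move=> c /pk[r r0 H]; exists r => // e /H[? ?]; by split; exact: hh.
Qed.

(* The interval may be unbounded. *)
Definition closed_interval (R : realType) (I : set R) : Prop :=
  [/\ I !=set0, is_interval I & closed I].

Record dynGraph (R : realType) (X : Type) := DynGraph {
  dynGraph_map :> R -> graph X;
  dynGraph_cosheaf : cosheaf_inducing dynGraph_map;
  dynGraph_lifespan : forall x : X, exists2 I : set R, closed_interval I &
    forall t, vertices (dynGraph_map t) x <-> I t
}.

Record formigram (R : realType) (X : Type) := Formigram {
  formigram_map :> R -> subpart X;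
  formigram_cosheaf : cosheaf_inducing formigram_map;
  formigram_lifespan : forall x : X, exists2 I : set R, closed_interval I &
    forall t, underlying_set (formigram_map t) x <-> I t
}.

Section Pi0Formigram.
Variables (R : realType) (X : Type) (G : dynGraph R X).

Fact pi0_lifespan (x : X) : exists2 I : set R, closed_interval I &
  forall t, underlying_set ((@pi0 X \o G) t) x <-> I t.
Proof.
have [I cI GI] := dynGraph_lifespan G x.
by exists I => // t; rewrite /= underlying_set_pi0.
Qed.

Definition formigram_of : formigram R X :=
  Formigram (cosheaf_inducing_comp (@pi0_homo X) (dynGraph_cosheaf G))
    pi0_lifespan.

End Pi0Formigram.

Section PullbackGraph.
Variables (Z X : Type) (phi : Z -> X).

Definition pull_graph (G : graph X) : graph Z.
Proof.
refine (@Graph Z (phi @^-1` vertices G)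
  (fun z z' => z <> z' /\
    (edge G (phi z) (phi z') \/ phi z = phi z' /\ vertices G (phi z))) _ _ _).
- move=> z z' [zz' H]; split; first exact: nesym.
  by case: H => [H|[e v]]; [left; exact: edge_sym|right; rewrite -e].
- by move=> z [].
- by move=> z z' [_ [H|[]//]]; exact: edge_vertices H.
Defined.

Lemma pull_graph_homo : {homo pull_graph : G H / (G <= H)%O}.
Proof.
move=> G H /le_graphP[V E]; apply/le_graphP; split=> [z /V//|z z' [zz' H']].
by split=> //; case: H' => [/E|[e /V]]; [left|right].
Qed.

Variables (R : realType) (G : dynGraph R X).

Fact pull_dynGraph_lifespan (z : Z) : exists2 I : set R, closed_interval I &
  forall t, vertices ((pull_graph \o G) t) z <-> I t.
Proof. exact: dynGraph_lifespan G (phi z). Qed.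

Definition pull_dynGraph : dynGraph R Z :=
  DynGraph (cosheaf_inducing_comp pull_graph_homo (dynGraph_cosheaf G))
    pull_dynGraph_lifespan.

End PullbackGraph.

Section PullbackSubpart.
Variables (Z X : Type) (phi : Z -> X).
Hypothesis phi_surj : set_surj [set: Z] [set: X] phi.

Fact pull_subpart_subproof (P : subpart X) :
  exists A, partition [set phi @^-1` B | B in blocks P] id A.
Proof.
exists (cover [set phi @^-1` B | B in blocks P] id); split=> //.
  move=> _ _ [B PB <-] [C PC <-] [z [/= Bz Cz]].
  by rewrite (block_uniq PB PC Bz Cz).
move=> _ [B PB <-]; have [x Bx] := block_neq0 PB.
by have [z _ zx] := phi_surj (I : [set: X] x); exists z; rewrite /= zx.
Qed.

Definition pull_subpart (P : subpart X) : subpart Z :=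
  SubPart (pull_subpart_subproof P).

Lemma pull_subpart_homo : {homo pull_subpart : P Q / (P <= Q)%O}.
Proof.
move=> P Q /le_subpartP PQ; apply/le_subpartP => _ [B /PQ[C QC BC] <-].
by exists (phi @^-1` C); [exists C|move=> z /BC].
Qed.

Variables (R : realType) (theta : formigram R X).

Fact pull_formigram_lifespan (z : Z) : exists2 I : set R, closed_interval I &
  forall t, underlying_set ((pull_subpart \o theta) t) z <-> I t.
Proof.
have [I cI tI] := formigram_lifespan theta (phi z).
exists I => // t; rewrite -tI; split=> [[_ [B PB <-] Bz]|[B PB Bz]].
  by exists B.
by exists (phi @^-1` B) => //; exists B.
Qed.

Definition pull_formigram : formigram R Z :=
  Formigram (cosheaf_inducing_comp pull_subpart_homo (formigram_cosheaf theta))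
    pull_formigram_lifespan.

End PullbackSubpart.

Record tripod (X Y : Type) := Tripod {
  apex : Type;
  legl : apex -> X;
  legr : apex -> Y;
  legl_surj : set_surj [set: apex] [set: X] legl;
  legr_surj : set_surj [set: apex] [set: Y] legr
}.

Section Distances.
Variables (R : realType) (X Y : Type).

Definition dynGraph_tripod (e : R) (GX : dynGraph R X) (GY : dynGraph R Y)
    (T : tripod X Y) : Prop :=
  (dI (pull_dynGraph (@legl X Y T) GX) (pull_dynGraph (@legr X Y T) GY)
     <= e%:E)%E.

Definition formigram_tripod (e : R) (tX : formigram R X) (tY : formigram R Y)
    (T : tripod X Y) : Prop :=
  (dI (pull_formigram (legl_surj T) tX) (pull_formigram (legr_surj T) tY)
     <= e%:E)%E.

Definition dI_dynG (GX : dynGraph R X) (GY : dynGraph R Y) : \bar R :=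
  ereal_inf [set e%:E | e in
    [set e : R | 0 <= e /\ exists T : tripod X Y, dynGraph_tripod e GX GY T]].

Definition dI_F (tX : formigram R X) (tY : formigram R Y) : \bar R :=
  ereal_inf [set e%:E | e in
    [set e : R | 0 <= e /\ exists T : tripod X Y, formigram_tripod e tX tY T]].

End Distances.

(* Main.v *)
Require Import Defs.
From Stdlib Require Import Relation_Operators.
From mathcomp Require Import all_boot all_order all_algebra.
From mathcomp Require Import all_classical all_reals all_analysis.

(** Every tripod between the dynamic graphs is used unchanged for the formigrams.
    Since [pi0] is left adjoint to [cliques], it preserves all joins, so it maps
    interval joins to interval joins and every interleaving to an interleaving;
    moreover [pi0] commutes with the pullback along a surjection. *)

Set Implicit Arguments.
Unset Strict Implicit.
Unset Printing Implicit Defensive.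
Import Order.TTheory GRing.Theory Num.Theory.
Local Open Scope classical_set_scope.
Local Open Scope ring_scope.

(** Least upper bounds are unique, and for a nonempty [A] that has one [supremum] chooses among them
    rather than returning [x0]. *)
Lemma supremum_eq (d : Order.disp_t) (T : porderType d) (x0 s : T) (A : set T) :
  A !=set0 -> supremums A s -> supremum x0 A = s.
Proof.
move=> /set0P A0 As; rewrite /supremum (negPf A0).
by apply: (is_subset1_supremums (A := A)) => //; exact: (xgetPex _ (ex_intro _ s As)).
Qed.

Section Residuated.
Variables (R : realType) (d1 d2 : Order.disp_t).
Variables (L : joinSemilatticeType d1) (M : joinSemilatticeType d2).
Variables (h : L -> M) (r : M -> L).
Hypothesis hr : forall x y, (h x <= y)%O = (x <= r y)%O.
Hypothesis supL : forall A : set L, exists s, supremums A s.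

Lemma residuated_homo : {homo h : x y / (x <= y)%O}.
Proof. by move=> x y xy; rewrite hr (le_trans xy)// -hr. Qed.

(** An upper bound [y] of the image transposes to the upper bound [r y] of [A]. *)
Lemma residuated_supremums (A : set L) s :
  supremums A s -> supremums (h @` A) (h s).
Proof.
move=> [As sA]; split; first by move=> _ [x /As xs <-]; exact: residuated_homo.
by move=> y hAy; rewrite hr; apply: sA => x Ax; rewrite -hr; apply: hAy; exists x.
Qed.

(** [supL] yields a genuine join over the interval, nonempty as [b <= d], so neither side falls back
    on its default value. *)
Lemma interval_join_residuated (f : R -> L) b d : b <= d ->
  interval_join (h \o f) b d = h (interval_join f b d).
Proof.
move=> bd; have [s fs] := supL (f @` `[b, d]).
have bb : [set` `[b, d]] b by rewrite /= in_itv /= lexx.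
rewrite /interval_join (supremum_eq _ _ fs); last by exists (f b), b.
apply: supremum_eq; first by exists (h (f b)), b.
by rewrite -image_comp; exact: residuated_supremums.
Qed.

Lemma interleaved_residuated e (f g : R -> L) : 0 <= e ->
  interleaved e f g -> interleaved e (h \o f) (h \o g).
Proof.
move=> e0 fg b d bd; have [fg1 gf1] := fg _ _ bd.
(* The thickened interval must also be nonempty for its join to commute with [h]. *)
have bde : b - e <= d + e by rewrite lerD// (le_trans _ e0)// oppr_le0.
by rewrite !interval_join_residuated//; split; exact: residuated_homo.
Qed.

Lemma dI_residuated (f g : R -> L) : (dI (h \o f) (h \o g) <= dI f g)%E.
Proof.
apply: ereal_inf_le_tmp => _ [e [e0 fg] <-].
by exists e => //; split=> //; exact: interleaved_residuated.
Qed.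

End Residuated.

(** The join is the union of all vertex sets and edge relations. *)
Lemma graph_supremums (X : Type) (A : set (graph X)) : exists s, supremums A s.
Proof.
pose E x y := exists2 G, A G & edge G x y.
have Es x y : E x y -> E y x by move=> [G AG Gxy]; exists G => //; exact: edge_sym.
have Ei x : ~ E x x by move=> [G _]; exact: edge_irr.
have Ev x y : E x y -> (\bigcup_(G in A) vertices G) x.
  by move=> [G AG Gxy]; exists G => //; exact: edge_vertices Gxy.
exists (Graph Es Ei Ev); split=> [G AG|H AH]; apply/le_graphP; split.
- by move=> x Gx; exists G.
- by move=> x y Gxy; exists G.
- by move=> x [G AG]; have /le_graphP[+ _] := AH _ AG; exact.
- by move=> x y [G AG]; have /le_graphP[_ +] := AH _ AG; exact.
Qed.

Section PullbackPi0.
Variables (Z X : Type) (phi : Z -> X).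
Hypothesis phi_surj : set_surj [set: Z] [set: X] phi.

(** Paths project along [phi], steps within a fibre becoming constant; conversely paths lift by
    surjectivity. Over a non-vertex the component of [z] is only [z], not the fibre. *)
Lemma component_pull_graph (G : graph X) (z : Z) : vertices G (phi z) ->
  component (pull_graph phi G) z = phi @^-1` component G (phi z).
Proof.
move=> Gz; apply/seteqP; split=> z'.
  elim=> {z Gz z'} [z z' [_ [zz'|[e _]]]|z|z z1 z' _ zz1 _]; rewrite /preimage /=.
  - exact: rt_step.
  - by rewrite e; exact: rt_refl.
  - exact: rt_refl.
  - exact: rt_trans.
rewrite /preimage /component /=; move ex : (phi z) Gz => x Gx; move ey : (phi z') => y xy.
(* Both lifts of the endpoints stay general, so that concatenated paths can meet at any chosen
   lift. *)
elim: xy Gx z z' ex ey => {x y}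
  [x y xy _|x Gx|x w y xw IH1 _ IH2 Gx] z z' zx zy.
- apply: rt_step; split; last by left; rewrite zx zy.
  by move=> e; move: xy; rewrite -zx -zy e; exact: edge_irr.
(* A constant path may lift to distinct points of one fibre, which are adjacent. *)
- have [->|zz'] := pselect (z = z'); first exact: rt_refl.
  by apply: rt_step; split=> //; right; rewrite zx zy.
- have [z1 _ z1w] := phi_surj (I : [set: X] w).
  apply: (rt_trans _ _ _ z1); first exact: IH1.
  by apply: IH2 => //; exact: component_vertices xw.
Qed.

Lemma pull_subpart_pi0 (G : graph X) :
  pull_subpart phi_surj (pi0 G) = pi0 (pull_graph phi G).
Proof.
apply/subpart_eq/seteqP; split=> [_ [_ [x Gx <-] <-]|_ [z Gz <-]].
  have [z _ zx] := phi_surj (I : [set: X] x).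
  by exists z; rewrite /preimage /= ?component_pull_graph zx.
by exists (component G (phi z)); [exists (phi z)|rewrite component_pull_graph].
Qed.

End PullbackPi0.

Lemma formigram_tripod_of (R : realType) (X Y : Type) (e : R)
    (GX : dynGraph R X) (GY : dynGraph R Y) (T : tripod X Y) :
  dynGraph_tripod e GX GY T ->
  formigram_tripod e (formigram_of GX) (formigram_of GY) T.
Proof.
apply: le_trans.
(* Both pullbacks are put in the form [pi0 \o f], to which the adjunction applies. *)
rewrite [X in dI X _](_ : _ = @pi0 _ \o pull_dynGraph (@legl _ _ T) GX); last first.
  by apply/funext => t; exact: pull_subpart_pi0.
rewrite [X in dI _ X](_ : _ = @pi0 _ \o pull_dynGraph (@legr _ _ T) GY); last first.
  by apply/funext => t; exact: pull_subpart_pi0.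
exact: dI_residuated (@pi0_le _) (@graph_supremums _) _ _.
Qed.

Theorem theorem4p17 (R : realType) (X Y : finType)
  (X_neq0 : (0 < #|X|)%N) (Y_neq0 : (0 < #|Y|)%N)
  (GX : dynGraph R X) (GY : dynGraph R Y) :
  (dI_F (formigram_of GX) (formigram_of GY) <= dI_dynG GX GY)%E.
Proof.
(* The infimum is antitone, so inclusion of the sets of admissible [e] suffices. *)
apply: ereal_inf_le_tmp => _ [e [e0 [T GT]] <-].
by exists e => //; split=> //; exists T; exact: formigram_tripod_of.
Qed.
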